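(* Let $r$ be a positive integer with $r\equiv 3\pmod 4$. There is no $Q$-polynomial association scheme with Krein array $$\left\{\frac{r^2+1}{2},\ \frac{r^2-1}{2},\ \frac{(r^2+1)^2}{2r(r+1)},\ \frac{(r-1)(r^2+1)}{4r},\ \frac{r^2+1}{2r};\ 1,\ \frac{(r-1)(r^2+1)}{2r(r+1)},\ \frac{(r+1)(r^2+1)}{4r},\ \frac{(r-1)(r^2+1)}{2r},\ \frac{r^2+1}{2}\right\}.$$
   Context: A (symmetric) association scheme with $D$ classes is a pair $(X,\{R_i\}_{i=0}^D)$ where $X$ is a finite set and $R_0,\dots,R_D$ are non-empty subsets of $X\times X$ whose adjacency matrices $A_0,\dots,A_D$ satisfy: $A_0=I$, $\sum_i A_i=J$, $A_i^\top=A_i$, and $A_iA_j=\sum_k p_{ij}^kA_k$ for nonnegative integers $p_{ij}^k$. The real span of the $A_i$ has a basis of primitive idempotents $E_0=\frac{1}{|X|}J,E_1,\dots,E_D$, closed under entrywise product $\circ$; the Krein parameters $q_{ij}^k$ are defined by $E_i\circ E_j=\frac1{|X|}\sum_k q_{ij}^kE_k$. An ordering $E_1,\dots,E_D$ is $Q$-polynomial if $(q_{1j}^k)_{k,j=0}^D$ is tridiagonal with all superdiagonal and subdiagonal entries nonzero; then with $b_i^*=q_{1,i+1}^i$, $c_i^*=q_{1,i-1}^i$, the Krein array is $\{b_0^*,\dots,b_{D-1}^*;c_1^*,\dots,c_D^*\}$. A $Q$-polynomial association scheme with a given Krein array is one admitting a $Q$-polynomial ordering with that Krein array. *)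

(* Defs.v *)
From HB Require Import structures.
From mathcomp Require Import all_boot all_order all_algebra.
From mathcomp Require Import reals.

Set Implicit Arguments.
Unset Strict Implicit.
Unset Printing Implicit Defensive.

Import Order.TTheory GRing.Theory Num.Theory.

Local Open Scope ring_scope.

(* Matrices indexed by a finite set X are square matrices of order #|X|, with *)
(* rows and columns labelled through the enumeration [enum_val] of X.         *)
Definition adjmx (R : realType) (X : finType) (S : {set X * X}) : 'M[R]_#|X| :=
  \matrix_(i, j) ((enum_val i, enum_val j) \in S)%:R.

Definition hadamard (R : realType) (m n : nat) (M N : 'M[R]_(m, n)) :
    'M[R]_(m, n) :=
  map2_mx *%R M N.

Section Scheme.

Variables (R : realType) (X : finType) (D : nat).

Local Notation classes := ('I_D.+1).
Local Notation mxX := ('M[R]_#|X|).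

Definition assoc_scheme (rel : classes -> {set X * X}) : Prop :=
  let A i : mxX := adjmx R (rel i) in
  [/\ forall i, rel i != set0,
      A ord0 = 1%:M,
      \sum_i A i = const_mx 1,
      forall i, (A i)^T = A i
    & exists p : classes -> classes -> classes -> nat,
        forall i j, A i *m A j = \sum_k (p i j k)%:R *: A k].

Definition bose_mesner (rel : classes -> {set X * X}) : {vspace mxX} :=
  <<[seq adjmx R (rel i) | i : classes]>>%VS.

Definition idempotent_in (V : {vspace mxX}) (E : mxX) : Prop :=
  E \in V /\ E *m E = E.

Definition primitive_idempotent (V : {vspace mxX}) (E : mxX) : Prop :=
  [/\ idempotent_in V E, E != 0
    & forall F G : mxX, idempotent_in V F -> idempotent_in V G ->
        F *m G = 0 -> G *m F = 0 -> E = F + G -> F = 0 \/ G = 0].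

Definition primitive_idempotent_basis
    (rel : classes -> {set X * X}) (E : classes -> mxX) : Prop :=
  [/\ E ord0 = #|X|%:R^-1 *: const_mx 1,
      forall i, primitive_idempotent (bose_mesner rel) (E i)
    & basis_of (bose_mesner rel) [seq E i | i : classes]].

(* [q i j k] stands for q_{ij}^k; it is uniquely determined by [E] whenever   *)
(* the E i are linearly independent.                                          *)
Definition krein_parameters
    (E : classes -> mxX) (q : classes -> classes -> classes -> R) : Prop :=
  forall i j, hadamard (E i) (E j) = #|X|%:R^-1 *: \sum_k q i j k *: E k.

(* [inord 1] is the class of index 1, as 0 < D.                               *)
Definition Q_polynomial (q : classes -> classes -> classes -> R) : Prop :=
  (0 < D)%N /\
  forall j k : classes,
    [/\ (j.+1 < k)%N \/ (k.+1 < j)%N -> q (inord 1) j k = 0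
      & (j.+1 == k)%N \/ (k.+1 == j)%N -> q (inord 1) j k != 0].

(* [b] lists b*_0, ..., b*_{D-1}, while [c] lists c*_1, ..., c*_D; hence the  *)
(* entry of index i of [c] is c*_{i+1} = q_{1,i}^{i+1}.                       *)
Definition krein_array
    (q : classes -> classes -> classes -> R) (b c : seq R) : Prop :=
  [/\ size b = D, size c = D
    & forall i, (i < D)%N ->
        b`_i = q (inord 1) (inord i.+1) (inord i) /\
        c`_i = q (inord 1) (inord i) (inord i.+1)].

Definition Q_polynomial_scheme
    (rel : classes -> {set X * X}) (b c : seq R) : Prop :=
  assoc_scheme rel /\
  exists (E : classes -> mxX) (q : classes -> classes -> classes -> R),
    [/\ primitive_idempotent_basis rel E, krein_parameters E q,
        Q_polynomial q & krein_array q b c].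

End Scheme.

(* Main.v *)
(* Every a*_i vanishes, so an entry t of |X| E_1 is a root of
   (t^2 - m^2) (t^2 - m^2 / r) (t^2 - m^2 / r^2), where m = (r^2 + 1) / 2. The
   scheme is thus an antipodal double cover of a graph with the parameters of
   the collinearity graph of a generalized quadrangle GQ(r, r), whose edges (the
   pairs with t = m / sqrt r or - m / sqrt r) it signs by a matrix S. The sums
   sum_w E_i(x,w) E_j(y,w) E_k(z,w) vanish whenever q_{ij}^k = 0; applied to
   q_{11}^4, q_{55}^4 and q_{15}^2 this shows that two non-adjacent neighbours
   of z have no common neighbour adjacent to z, so the neighbourhood of z in the
   quotient is a disjoint union of r-cliques. After making all signs at z
   positive, S has zero row sums on such a clique, hence takes the value 1 on
   r (r - 1) / 2 ordered pairs. This number is even by symmetry, which is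
   impossible for r = 3 mod 4. *)

Require Import Defs.
From HB Require Import structures.
From mathcomp Require Import all_boot all_order all_algebra.
From mathcomp Require Import reals ring lra zify.

Import Order.TTheory GRing.Theory Num.Theory.

Local Open Scope ring_scope.

Set Implicit Arguments.
Unset Strict Implicit.
Unset Printing Implicit Defensive.

(** * Vanishing triple sums and a parity count *)

Lemma sum_mul_mxtrace (R : comPzRingType) (n : nat) (M N : 'M[R]_n) :
  \sum_a \sum_b M a b * N a b = \tr (M *m N^T).
Proof.
by apply: eq_bigr => a _; rewrite mxE; apply: eq_bigr => b _; rewrite mxE.
Qed.

Lemma symmx (R : Type) (n : nat) (M : 'M[R]_n) (a b : 'I_n) :
  M^T = M -> M a b = M b a.
Proof. by move=> trM; rewrite -[in LHS]trM mxE. Qed.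

(* The sum of the squares of all these triple products is the sum of the
   entries of the Hadamard product of A, B and C. *)
Lemma triple_product_eq0 (R : realDomainType) (n : nat) (A B C : 'M[R]_n) :
    A^T = A -> B^T = B -> C^T = C ->
    A *m A = A -> B *m B = B -> C *m C = C ->
    \sum_a \sum_b A a b * B a b * C a b = 0 ->
  forall x y z, \sum_w A x w * B y w * C z w = 0.
Proof.
move=> trA trB trC AA BB CC sum0.
(* A symmetric idempotent is the Gram matrix of its own columns; this sums out [x], [y] and [z]
   below. *)
have gram (M : 'M[R]_n) a b : M^T = M -> M *m M = M ->
    \sum_x M x a * M x b = M a b.
  move=> trM MM; rewrite -[in RHS]MM mxE; apply: eq_bigr => x _.
  by rewrite (symmx x a).
pose W x y z := \sum_w A x w * B y w * C z w.
have sumW : \sum_x \sum_y \sum_z W x y z ^+ 2 = 0.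
  transitivity (\sum_x \sum_y \sum_z \sum_a \sum_b
      (A x a * A x b) * ((B y a * B y b) * (C z a * C z b))).
    apply: eq_bigr => x _; apply: eq_bigr => y _; apply: eq_bigr => z _.
    rewrite expr2 big_distrlr /=.
    by apply: eq_bigr => a _; apply: eq_bigr => b _; ring.
  transitivity (\sum_a \sum_b \sum_x \sum_y \sum_z
      (A x a * A x b) * ((B y a * B y b) * (C z a * C z b))).
    under eq_bigr => x _ do under eq_bigr => y _ do rewrite exchange_big.
    under eq_bigr => x _ do rewrite exchange_big.
    rewrite exchange_big; apply: eq_bigr => a _ /=.
    under eq_bigr => x _ do under eq_bigr => y _ do rewrite exchange_big.
    under eq_bigr => x _ do rewrite exchange_big.
    by rewrite exchange_big.
  apply: etrans sum0; apply: eq_bigr => a _; apply: eq_bigr => b _.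
  under eq_bigr => x _ do under eq_bigr => y _ do rewrite -2!mulr_sumr gram //.
  under eq_bigr => x _ do rewrite -mulr_sumr -mulr_suml gram //.
  by rewrite -mulr_suml gram // mulrA.
move=> x y z; apply/eqP; rewrite -[_ == 0](sqrf_eq0 (W x y z)).
have W2 a b c : 0 <= W a b c ^+ 2 by exact: sqr_ge0.
have Wx : \sum_y \sum_z W x y z ^+ 2 = 0.
  apply: (psumr_eq0P _ sumW) => // a _.
  by do 2![apply: sumr_ge0 => ? _].
have Wxy : \sum_z W x y z ^+ 2 = 0.
  by apply: (psumr_eq0P _ Wx) => // b _; apply: sumr_ge0.
by apply/eqP; apply: (psumr_eq0P _ Wxy).
Qed.

(* This is the vanishing of triple intersection sums forced by a vanishing
   Krein parameter: [c k] plays the role of q_{ij}^k / |X|. *)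
Lemma krein_triple_eq0 (R : realDomainType) (n D : nat)
    (E : 'I_D -> 'M[R]_n) (c : 'I_D -> R) (i j k : 'I_D) :
    (forall l, (E l)^T = E l) ->
    (forall l l', E l *m E l' = if l == l' then E l else 0) ->
    (forall a b, E i a b * E j a b = \sum_l c l * E l a b) -> c k = 0 ->
  forall x y z, \sum_w E i x w * E j y w * E k z w = 0.
Proof.
move=> trE EE Eij ck0; apply: triple_product_eq0 => //; try by rewrite EE eqxx.
transitivity (\sum_l \sum_a \sum_b c l * (E l a b * E k a b)).
  rewrite [RHS]exchange_big; apply: eq_bigr => a _ /=.
  rewrite [RHS]exchange_big /=.
  by apply: eq_bigr => b _; rewrite Eij mulr_suml; apply: eq_bigr => l _; ring.
rewrite big1 // => l _.
under eq_bigr => a _ do rewrite -mulr_sumr.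
rewrite -mulr_sumr sum_mul_mxtrace trE EE; case: eqP => [->|_].
  by rewrite ck0 mul0r.
by rewrite mxtrace0 mulr0.
Qed.

(** The terms at (a, b) and (b, a) pair up, and the diagonal contributes nothing. *)
Lemma sum_symmetric_even (n : nat) (f : 'I_n -> 'I_n -> nat) :
    (forall a b, f a b = f b a) -> (forall a, f a a = 0%N) ->
  ~~ odd (\sum_a \sum_b f a b).
Proof.
move=> fC f0; suff -> : (\sum_a \sum_b f a b =
    (\sum_(a < n) \sum_(b < n | a < b) f a b).*2)%N by rewrite odd_double.
have gtE : (\sum_(a < n) \sum_(b < n | b < a) f a b =
            \sum_(a < n) \sum_(b < n | a < b) f a b)%N.
  rewrite (exchange_big_dep predT) //=.
  by apply: eq_bigr => a _; apply: eq_bigr => b _.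
rewrite -addnn -[X in (_ = _ + X)%N]gtE -big_split; apply: eq_bigr => a _ /=.
rewrite (bigID (fun b : 'I_n => a < b)%N) /=; congr (_ + _)%N.
rewrite (bigD1 a) ?ltnn //= f0 add0n; apply: eq_bigl => b.
by rewrite -leqNgt ltn_neqAle andbC.
Qed.

(** * Possible entries of the matrices |X| E_i *)

Section KreinEntries.

Variables (R : realType) (s : R).

Local Notation x := (s ^+ 2).
Local Notation m := ((x ^+ 2 + 1) / 2).

(** These are the rows of the second eigenmatrix, grouped in pairs by the sign [e]. The parameter
    [s] stands for sqrt r, so that [x] is r. *)
Variant entry_spec (v1 v2 v3 v4 v5 : R) : Prop :=
| EntryAntipodal e of e = 1 \/ e = -1 & v1 = e * m &
    v2 = x * (x + 1) ^+ 2 / 2 & v3 = e * (x * (x ^+ 2 + 1)) & v4 = x * m &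
    v5 = e * m
| EntryCollinear e of e = 1 \/ e = -1 & v1 = e * (m / s) &
    v2 = (x ^+ 2 - 1) / 2 & v3 = 0 & v4 = - m & v5 = - (e * (m / s))
| EntryFar e of e = 1 \/ e = -1 & v1 = e * (m / x) &
    v2 = - (x + 1) ^+ 2 / (2 * x) & v3 = - (e * (2 * m / x)) & v4 = m / x &
    v5 = e * (m / x).

(** The first four relations make v2, ..., v5 polynomials in v1; the fifth then becomes an equation
    of degree six in v1. *)
Lemma krein_entryP (v1 v2 v3 v4 v5 : R) : 1 < s ->
    v1 * v1 = m + (x - 1) * (x ^+ 2 + 1) / (2 * x * (x + 1)) * v2 ->
    v1 * v2 = (x ^+ 2 - 1) / 2 * v1 + (x + 1) * (x ^+ 2 + 1) / (4 * x) * v3 ->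
    v1 * v3 = (x ^+ 2 + 1) ^+ 2 / (2 * x * (x + 1)) * v2 +
              (x - 1) * (x ^+ 2 + 1) / (2 * x) * v4 ->
    v1 * v4 = (x - 1) * (x ^+ 2 + 1) / (4 * x) * v3 + m * v5 ->
    v1 * v5 = (x ^+ 2 + 1) / (2 * x) * v4 ->
  entry_spec v1 v2 v3 v4 v5.
Proof.
move=> s_gt1.
have s0 : s != 0 by rewrite gt_eqF //; lra.
have x1 : 1 < x by nra.
have x2 : 1 < x ^+ 2 by nra.
have x3 : 0 < x ^+ 3 by rewrite exprn_gt0 //; lra.
have xm1 : x - 1 != 0 by rewrite gt_eqF //; lra.
have xp1 : x + 1 != 0 by rewrite gt_eqF //; lra.
have x2p1 : x ^+ 2 + 1 != 0 by rewrite gt_eqF //; lra.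
move=> h1 h2 h3 h4 h5.
have E2 : v2 = (v1 * v1 - m) / ((x - 1) * (x ^+ 2 + 1) / (2 * x * (x + 1))).
  by rewrite h1; field; rewrite s0 xm1 x2p1 xp1.
have E3 : v3 = (v1 * v2 - (x ^+ 2 - 1) / 2 * v1) /
    ((x + 1) * (x ^+ 2 + 1) / (4 * x)).
  by rewrite h2; field; rewrite s0 x2p1 xp1.
have E4 : v4 = (v1 * v3 - (x ^+ 2 + 1) ^+ 2 / (2 * x * (x + 1)) * v2) /
    ((x - 1) * (x ^+ 2 + 1) / (2 * x)).
  by rewrite h3; field; rewrite s0 xm1 x2p1 xp1.
have E5 : v5 = (v1 * v4 - (x - 1) * (x ^+ 2 + 1) / (4 * x) * v3) / m.
  by rewrite h4; field; rewrite s0 x2p1.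
(* The factors after [x ^+ 3] are c*_2, ..., c*_5, by which the elimination divided; [x ^+ 3] is the
   leading coefficient of the left-hand side. *)
have poly : (v1 ^+ 2 - m ^+ 2) * ((v1 * s) ^+ 2 - m ^+ 2) *
    ((v1 * x) ^+ 2 - m ^+ 2) = x ^+ 3 *
    ((x - 1) * (x ^+ 2 + 1) / (2 * x * (x + 1))) *
    ((x + 1) * (x ^+ 2 + 1) / (4 * x)) * ((x - 1) * (x ^+ 2 + 1) / (2 * x)) *
    m * (v1 * v5 - (x ^+ 2 + 1) / (2 * x) * v4).
  by rewrite E5 E4 E3 E2; field; rewrite s0 xm1 x2p1 xp1.
move: poly; rewrite h5 subrr mulr0 => /eqP; rewrite !mulf_eq0 -orbA.
have sgn (u w : R) : u ^+ 2 - w ^+ 2 == 0 ->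
    exists2 e, e = 1 \/ e = -1 & u = e * w.
  rewrite subr_eq0 eqf_sqr => /orP[] /eqP ->.
    by exists 1; [left | rewrite mul1r].
  by exists (-1); [right | rewrite mulN1r].
case/or3P => /sgn [e eP ev].
- by apply: (EntryAntipodal eP); rewrite ?E5 ?E4 ?E3 ?E2 ev;
    case: eP => ->; field; rewrite ?s0 ?xm1 ?x2p1 ?xp1.
- have {}ev : v1 = e * (m / s) by rewrite mulrA -ev; field.
  by apply: (EntryCollinear eP); rewrite ?E5 ?E4 ?E3 ?E2 ev;
    case: eP => ->; field; rewrite ?s0 ?xm1 ?x2p1 ?xp1.
- have {}ev : v1 = e * (m / x) by rewrite mulrA -ev; field.
  by apply: (EntryFar eP); rewrite ?E5 ?E4 ?E3 ?E2 ev;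
    case: eP => ->; field; rewrite ?s0 ?xm1 ?x2p1 ?xp1.
Qed.

End KreinEntries.

Lemma sum_ord6 (V : nmodType) (F : 'I_6 -> V) :
  \sum_l F l = F (@Ordinal 6 0 isT) + F (@Ordinal 6 1 isT) +
    F (@Ordinal 6 2 isT) + F (@Ordinal 6 3 isT) + F (@Ordinal 6 4 isT) +
    F (@Ordinal 6 5 isT).
Proof.
rewrite !big_ord_recl big_ord0 addr0 !addrA.
by do !congr (_ + _); congr F; apply: val_inj.
Qed.

(** Summing over [l] puts the identity in place of [E l], so only w = c survives. *)
Lemma krein_triple_sum (R : pzRingType) (n D : nat) (E : 'I_D -> 'M[R]_n)
    (A B : 'M[R]_n) (a b c : 'I_n) :
    \sum_l E l = 1%:M ->
  \sum_l \sum_w A a w * B b w * E l c w = A a c * B b c.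
Proof.
move=> sumE; rewrite exchange_big /=.
transitivity (\sum_w A a w * B b w * (c == w)%:R).
  apply: eq_bigr => w _; rewrite -mulr_sumr; congr (_ * _).
  by have /matrixP/(_ c w) := sumE; rewrite summxE mxE.
rewrite (bigD1 c) //= eqxx mulr1 big1 ?addr0 // => w /negbTE wc.
by rewrite eq_sym wc mulr0.
Qed.

(** * The signed collinearity relation *)

Section PseudoQuadrangle.

Variables (R : realType) (s : R) (n : nat) (E : 'I_6 -> 'M[R]_n).

Local Notation x := (s ^+ 2).
Local Notation m := ((x ^+ 2 + 1) / 2).
Local Notation o k := (@Ordinal 6 k isT).
Local Notation E_ k := (E (o k)).
Local Notation v k a b := (n%:R * E_ k a b).

Hypothesis s_gt1 : 1 < s.
Hypothesis n_gt0 : (0 < n)%N.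
Hypothesis trE : forall l, (E l)^T = E l.
Hypothesis EE : forall l l', E l *m E l' = if l == l' then E l else 0.
Hypothesis sumE : \sum_l E l = 1%:M.
Hypothesis E0 : forall a b, v 0 a b = 1.
Hypothesis diagE : forall a, v 1 a a = m.
(** The expansion of E_1 o E_j read entrywise, with n = |X|; as every a*_j is 0, only b*_{j-1} and
    c*_{j+1} occur. *)
Hypothesis krein : forall a b,
  [/\ v 1 a b * v 1 a b =
        m * v 0 a b + (x - 1) * (x ^+ 2 + 1) / (2 * x * (x + 1)) * v 2 a b,
      v 1 a b * v 2 a b =
        (x ^+ 2 - 1) / 2 * v 1 a b +
        (x + 1) * (x ^+ 2 + 1) / (4 * x) * v 3 a b,
      v 1 a b * v 3 a b =
        (x ^+ 2 + 1) ^+ 2 / (2 * x * (x + 1)) * v 2 a b +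
        (x - 1) * (x ^+ 2 + 1) / (2 * x) * v 4 a b,
      v 1 a b * v 4 a b =
        (x - 1) * (x ^+ 2 + 1) / (4 * x) * v 3 a b + m * v 5 a b &
      v 1 a b * v 5 a b = (x ^+ 2 + 1) / (2 * x) * v 4 a b].

Let entryP a b :
  entry_spec s (v 1 a b) (v 2 a b) (v 3 a b) (v 4 a b) (v 5 a b).
Proof.
by have [h1 h2 h3 h4 h5] := krein a b; apply: krein_entryP => //;
  rewrite h1 E0 mulr1.
Qed.

Let x_gt1 : 1 < x. Proof. by move: s_gt1 => s1; nra. Qed.

Let m_gt0 : 0 < m. Proof. by move: x_gt1 => x1; nra. Qed.

Let m_neq0 : m != 0. Proof. by rewrite gt_eqF ?m_gt0. Qed.

Let s_neq0 : s != 0. Proof. by rewrite gt_eqF ?(lt_trans _ s_gt1). Qed.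

Let xp1_neq0 : x + 1 != 0.
Proof. by rewrite gt_eqF //; move: x_gt1 => x1; lra. Qed.

Let x2p1_neq0 : x ^+ 2 + 1 != 0.
Proof. by rewrite gt_eqF //; move: m_gt0 => m0; lra. Qed.

Let n_neq0 : n%:R != 0 :> R. Proof. by rewrite pnatr_eq0 -lt0n. Qed.

Let sum_entries a b :
  v 0 a b + v 1 a b + v 2 a b + v 3 a b + v 4 a b + v 5 a b =
  n%:R * (a == b)%:R.
Proof.
have /matrixP/(_ a b) := sumE; rewrite sum_ord6 !mxE => <-; ring.
Qed.

(** The diagonal value m exceeds m / s and m / x, so the diagonal is the case [EntryAntipodal] with
    e = 1, whose six values add up to n. *)
Lemma krein_order : n%:R = 2 * (x + 1) * (x ^+ 2 + 1) :> R.
Proof.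
pose a := Ordinal n_gt0.
have := sum_entries a a; rewrite eqxx mulr1 E0.
have x1 := x_gt1; have s1 := s_gt1; have m0 := m_gt0.
have := diagE a; case: (entryP a a) => e eP -> -> -> -> -> em.
- have -> : e = 1 by case: eP em => -> //; lra.
  by move=> <-; field.
- exfalso; move: em; suff : e * (m / s) < m by lra.
  have ms : m / s < m by rewrite ltr_pdivrMr ?(lt_trans _ s1) // ltr_pMr.
  have ms0 : 0 < m / s by rewrite divr_gt0 // (lt_trans _ s1).
  by case: eP => ->; lra.
- exfalso; move: em; suff : e * (m / x) < m by lra.
  have ms : m / x < m by rewrite ltr_pdivrMr ?(lt_trans _ x1) // ltr_pMr.
  have ms0 : 0 < m / x by rewrite divr_gt0 // (lt_trans _ x1).
  by case: eP => ->; lra.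
Qed.

(* S is the signed collinearity matrix of the antipodal quotient, lifted to the
   scheme; F is its signed non-collinearity matrix plus r times the signed
   identity, and B = S o S is the collinearity relation. *)
Definition collinear_sign : 'M[R]_n := (2 * s * (x + 1)) *: (E_ 1 - E_ 5).

Definition far_sign : 'M[R]_n := (2 * x * (x + 1)) *: (E_ 1 + E_ 5).

Definition collinear : 'M[R]_n :=
  (2 * x * (x + 1)) *: E_ 0 + (2 * (x - 1)) *: E_ 2 - (2 * (x + 1)) *: E_ 4.

Local Notation S := collinear_sign.
Local Notation F := far_sign.
Local Notation B := collinear.

(** The values of [B *m B] are twice the numbers r - 1 and r + 1 of common neighbours in a GQ(r, r),
    the cover being double. *)
Variant pair_spec (a b : 'I_n) : Prop :=
| PairAntipodal of S a b = 0 & B a b = 0 & v 1 a b = - m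
| PairEqual of S a b = 0 & B a b = 0 & a = b
| PairCollinear e of e = 1 \/ e = -1 & S a b = e & B a b = 1 & F a b = 0 &
    (B *m B) a b = 2 * (x - 1) & E_ 1 a b = e / (4 * s * (x + 1)) &
    E_ 5 a b = - (e / (4 * s * (x + 1)))
| PairFar e of e = 1 \/ e = -1 & S a b = 0 & B a b = 0 & F a b = e &
    (B *m B) a b = 2 * (x + 1).

(** The coefficients of [B] are its eigenvalues, twice those of a GQ(r, r); orthogonality of the
    idempotents squares them. *)
Lemma collinear2 : B *m B = (2 * x * (x + 1)) ^+ 2 *: E_ 0 +
  (2 * (x - 1)) ^+ 2 *: E_ 2 + (2 * (x + 1)) ^+ 2 *: E_ 4.
Proof.
rewrite /collinear !(mulmxDl, mulmxDr, mulNmx, mulmxN) -!scalemxAl.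
rewrite -!scalemxAr !EE /= !scaler0.
by apply/matrixP => a b; rewrite !mxE; ring.
Qed.

Lemma collinear_sign2 : S *m S = (2 * (x + 1)) *: F.
Proof.
rewrite /collinear_sign /far_sign.
rewrite -!scalemxAl -!scalemxAr !(mulmxDl, mulmxDr, mulNmx, mulmxN) !EE /=.
by apply/matrixP => a b; rewrite !mxE; ring.
Qed.

(** [B] involves only E_0, E_2, E_4 and [S] only E_1, E_5. *)
Lemma mul_collinear_sign : B *m S = 0.
Proof.
rewrite /collinear_sign /collinear !(mulmxDl, mulmxDr, mulNmx, mulmxN).
rewrite -!scalemxAl -!scalemxAr !(mulmxDl, mulmxDr, mulNmx, mulmxN) !EE /=.
by apply/matrixP => a b; rewrite !mxE; ring.
Qed.

Lemma trmx_collinear_sign : S^T = S.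
Proof. by rewrite /collinear_sign linearZ linearB /= !trE. Qed.

Lemma trmx_collinear : B^T = B.
Proof. by rewrite /collinear linearB linearD /= !linearZ /= !trE. Qed.

Lemma pairP a b : pair_spec a b.
Proof.
have nE := krein_order; have x1 := x_gt1; have s1 := s_gt1.
have EV l : E l a b = n%:R * E l a b / (2 * (x + 1) * (x ^+ 2 + 1)).
  by rewrite -nE; field.
have SE : S a b = 2 * s * (x + 1) * (E_ 1 a b - E_ 5 a b) by rewrite !mxE.
have FE : F a b = 2 * x * (x + 1) * (E_ 1 a b + E_ 5 a b) by rewrite !mxE.
have BE : B a b = 2 * x * (x + 1) * E_ 0 a b + 2 * (x - 1) * E_ 2 a b -
    2 * (x + 1) * E_ 4 a b by rewrite !mxE.
have BBE : (B *m B) a b = (2 * x * (x + 1)) ^+ 2 * E_ 0 a b +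
    (2 * (x - 1)) ^+ 2 * E_ 2 a b + (2 * (x + 1)) ^+ 2 * E_ 4 a b.
  by rewrite collinear2 !mxE.
have E0v := EV (o 0); rewrite E0 in E0v.
have := sum_entries a b; rewrite E0.
have := EV (o 1); have := EV (o 2).
have := EV (o 4); have := EV (o 5).
case: (entryP a b) => e eP -> -> -> -> -> E5v E4v E2v E1v sumv.
- have S0 : S a b = 0 by rewrite SE E1v E5v; field; rewrite xp1_neq0 x2p1_neq0.
  have B0 : B a b = 0.
    by rewrite BE E0v E2v E4v; field; rewrite xp1_neq0 x2p1_neq0.
  case: eP => eE; last by apply: PairAntipodal => //; rewrite E1v nE eE; field;
    rewrite xp1_neq0 x2p1_neq0.
  (* For e = 1 all six values are positive, whereas off the diagonal they sum to 0. *)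
  apply: PairEqual => //; apply/eqP; apply: contraT => /negbTE ab.
  move: sumv; rewrite ab mulr0 eE; nra.
- by apply: (PairCollinear eP);
    rewrite ?SE ?FE ?BE ?BBE ?E0v ?E1v ?E2v ?E4v ?E5v; field;
    rewrite ?s_neq0 ?xp1_neq0 ?x2p1_neq0.
- by apply: (PairFar eP); rewrite ?SE ?FE ?BE ?BBE ?E0v ?E1v ?E2v ?E4v ?E5v;
    field;
    rewrite ?s_neq0 ?xp1_neq0 ?x2p1_neq0.
Qed.


Lemma collinear_sqr a b : B a b = S a b ^+ 2.
Proof.
case: (pairP a b) => [-> -> _|-> -> _|e eP -> -> _ _ _ _|e _ -> -> _ _].
- by rewrite expr0n.
- by rewrite expr0n.
- by case: eP => ->; rewrite ?sqrrN expr1n.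
- by rewrite expr0n.
Qed.

(** * Triple sums and common neighbours *)

Local Notation tri i j k a b c := (\sum_w E_ i a w * E_ j b w * E_ k c w).

Let triple_supp i j (c : 'I_6 -> R) :
    (forall a b, E i a b * E j a b = \sum_l c l * E l a b) ->
  forall l, c l = 0 -> forall a b d, \sum_w E i a w * E j b w * E l d w = 0.
Proof. by move=> Eij l cl; apply: krein_triple_eq0 (Eij) (cl). Qed.

Let E11 a b : E_ 1 a b * E_ 1 a b = \sum_(l < 6)
  (if val l is 0 then m / n%:R else if val l is 2 then
     (x - 1) * (x ^+ 2 + 1) / (2 * x * (x + 1)) / n%:R else 0) * E l a b.
Proof.
rewrite sum_ord6 /= !mul0r !addr0.
apply: (mulfI n_neq0); apply: (mulfI n_neq0).
have [h _ _ _ _] := krein a b; transitivity (v 1 a b * v 1 a b); first by ring.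
by rewrite h; field; rewrite n_neq0 s_neq0 xp1_neq0.
Qed.

(** In every relation E_1 and E_5 agree up to sign; hence q_{55}^l = q_{11}^l. *)
Let E55 a b : E_ 5 a b * E_ 5 a b = E_ 1 a b * E_ 1 a b.
Proof.
apply: (mulfI n_neq0); apply: (mulfI n_neq0).
transitivity (v 5 a b * v 5 a b); first by ring.
transitivity (v 1 a b * v 1 a b); last by ring.
by case: (entryP a b) => e eP -> _ _ _ ->; rewrite ?mulrNN.
Qed.

Let E15 a b : E_ 1 a b * E_ 5 a b = \sum_(l < 6)
  (if val l is 4 then (x ^+ 2 + 1) / (2 * x) / n%:R else 0) * E l a b.
Proof.
rewrite sum_ord6 /= !mul0r !add0r addr0.
apply: (mulfI n_neq0); apply: (mulfI n_neq0).
have [_ _ _ _ h] := krein a b; transitivity (v 1 a b * v 5 a b); first by ring.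
by rewrite h; field; rewrite n_neq0 s_neq0.
Qed.

Let tri0 i j a b c :
  \sum_w E i a w * E j b w * E_ 0 c w = (E i *m E j) a b / n%:R.
Proof.
rewrite mxE mulr_suml; apply: eq_bigr => w _.
rewrite (symmx b w (trE j)); congr (_ * _).
by apply: (mulfI n_neq0); rewrite E0 mulfV ?n_neq0.
Qed.

(* In the notation of triple intersection numbers, this combines the vanishing
   of q_{11}^4, q_{55}^4 and q_{15}^2. *)
Lemma collinear_triple a b c :
    S a c != 0 -> S b c != 0 ->
  \sum_w S a w * S b w * B c w = 2 * (F a b - S a c * S b c).
Proof.
move=> ac bc.
have T i j : \sum_l \sum_w E i a w * E j b w * E l c w = E i a c * E j b c.
  exact: krein_triple_sum sumE.
have E51 u w : E_ 5 u w * E_ 1 u w = \sum_(l < 6)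
    (if val l is 4 then (x ^+ 2 + 1) / (2 * x) / n%:R else 0) * E l u w.
  by rewrite mulrC E15.
have E55' u w : E_ 5 u w * E_ 5 u w = \sum_(l < 6)
  (if val l is 0 then m / n%:R else if val l is 2 then
     (x - 1) * (x ^+ 2 + 1) / (2 * x * (x + 1)) / n%:R else 0) * E l u w.
  by rewrite E55 E11.
have z11 := triple_supp E11; have z55 := triple_supp E55'.
have z15 := triple_supp E15; have z51 := triple_supp E51.
(* In the total [T] over the third index only the indices 0 and 2 survive, and the former is known
   from [tri0]. *)
have t112 : tri 1 1 2 a b c = E_ 1 a c * E_ 1 b c - E_ 1 a b / n%:R.
  rewrite -T sum_ord6 tri0 EE /= (z11 (o 1)) // (z11 (o 3)) //
    (z11 (o 4)) // (z11 (o 5)) //; ring.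
have t552 : tri 5 5 2 a b c = E_ 5 a c * E_ 5 b c - E_ 5 a b / n%:R.
  rewrite -T sum_ord6 tri0 EE /= (z55 (o 1)) // (z55 (o 3)) //
    (z55 (o 4)) // (z55 (o 5)) //; ring.
have t154 : tri 1 5 4 a b c = E_ 1 a c * E_ 5 b c.
  by rewrite -T sum_ord6 (z15 (o 0)) // (z15 (o 1)) // (z15 (o 2)) //
    (z15 (o 3)) // (z15 (o 5)) // !add0r addr0.
have t514 : tri 5 1 4 a b c = E_ 5 a c * E_ 1 b c.
  by rewrite -T sum_ord6 (z51 (o 0)) // (z51 (o 1)) // (z51 (o 2)) //
    (z51 (o 3)) // (z51 (o 5)) // !add0r addr0.
have -> : \sum_w S a w * S b w * B c w = (2 * s * (x + 1)) ^+ 2 *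
    (2 * x * (x + 1) *
       (tri 1 1 0 a b c + tri 5 5 0 a b c - tri 1 5 0 a b c - tri 5 1 0 a b c)
   + 2 * (x - 1) *
       (tri 1 1 2 a b c + tri 5 5 2 a b c - tri 1 5 2 a b c - tri 5 1 2 a b c)
   - 2 * (x + 1) *
     (tri 1 1 4 a b c + tri 5 5 4 a b c - tri 1 5 4 a b c - tri 5 1 4 a b c)).
  rewrite -!sumrN -!big_split /= !mulr_sumr -!sumrN -!big_split mulr_sumr.
  by apply: eq_bigr => w _ /=; rewrite !mxE; ring.
rewrite t112 t552 t154 t514 !tri0 !EE /= [(0 : 'M_n) a b]mxE
  (z15 (o 2)) // (z51 (o 2)) // (z11 (o 4)) // (z55 (o 4)) //.
have FE : F a b = 2 * x * (x + 1) * (E_ 1 a b + E_ 5 a b) by rewrite !mxE.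
rewrite FE; have nE := krein_order.
case: (pairP a c) ac => [->|->|e _ -> _ _ _ -> ->|e _ ->];
  rewrite ?eqxx // => _.
case: (pairP b c) bc => [->|->|f _ -> _ _ _ -> ->|f _ ->];
  rewrite ?eqxx // => _.
by rewrite nE; field; rewrite s_neq0 xp1_neq0 x2p1_neq0.
Qed.

Lemma collinear_sign_val a b : [\/ S a b = 0, S a b = 1 | S a b = -1].
Proof.
case: (pairP a b) => [->|->|e [] -> ->|e _ ->] *; by constructor.
Qed.

(* All 2-paths between a and b have the same sign, by comparing (S^2)(a,b) with
   (B^2)(a,b); so in [collinear_triple] no cancellation can occur. *)
Lemma collinear_clique a b c w : F a b = 1 \/ F a b = -1 ->
    (B *m B) a b = 2 * (x + 1) ->
    S a c != 0 -> S b c != 0 -> S a w != 0 -> S b w != 0 -> S c w = 0.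
Proof.
move=> Fab BBab ac bc aw bw.
have FF : F a b * F a b = 1 by case: Fab => ->; ring.
(* The differences are nonnegative, and they sum to 2 (x + 1) (1 - F(a,b)^2) = 0. *)
have pathsign u : B a u * B b u = F a b * (S a u * S b u).
  apply/eqP; rewrite -subr_eq0; apply/eqP.
  have sum0 : \sum_u (B a u * B b u - F a b * (S a u * S b u)) = 0.
    rewrite sumrB -mulr_sumr.
    have -> : \sum_u B a u * B b u = (B *m B) a b.
      by rewrite mxE; apply: eq_bigr => i _; rewrite (symmx b i trmx_collinear).
    have -> : \sum_u S a u * S b u = (S *m S) a b.
      rewrite mxE; apply: eq_bigr => i _.
      by rewrite (symmx b i trmx_collinear_sign).
    have -> : (S *m S) a b = 2 * (x + 1) * F a b.
      by rewrite collinear_sign2 [LHS]mxE.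
    by rewrite BBab; ring: FF.
  apply: (psumr_eq0P _ sum0) => // i _; rewrite !collinear_sqr.
  by case: (collinear_sign_val a i) => ->; case: (collinear_sign_val b i) => ->;
    case: Fab => ->; lra.
have abc : S a c * S b c = F a b.
  have := pathsign c; rewrite !collinear_sqr.
  move: ac bc; case: (collinear_sign_val a c) => ->; rewrite ?eqxx // => _;
  case: (collinear_sign_val b c) => ->; rewrite ?eqxx // => _; lra.
(* By [abc] the right-hand side of [collinear_triple] is 0; multiplying by F(a,b) turns each term
   into a nonnegative one. *)
have sumBBB : \sum_u B a u * B b u * B c u = 0.
  have := collinear_triple ac bc; rewrite abc subrr mulr0.
  move/(congr1 (fun t => F a b * t)); rewrite mulr0 mulr_sumr => h.
  by apply: etrans h; apply: eq_bigr => u _; rewrite pathsign; ring.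
have /eqP : B a w * B b w * B c w = 0.
  apply: (psumr_eq0P _ sumBBB) => // i _.
  by rewrite !collinear_sqr -!exprMn sqr_ge0.
rewrite !collinear_sqr !mulf_eq0 !orbb (negbTE aw) (negbTE bw) /=.
by move/eqP.
Qed.


(** * Cliques in a neighbourhood and their signs *)

Lemma collinear_sign_diag a : S a a = 0.
Proof.
have := diagE a; rewrite krein_order; case: (pairP a a) => // e eP _ _ _ _ -> _.
have s1 := s_gt1; have x1 := x_gt1; have m0 := m_gt0.
have -> : 2 * (x + 1) * (x ^+ 2 + 1) * (e / (4 * s * (x + 1))) = e / s * m.
  by field; rewrite s_neq0 xp1_neq0.
(* A collinear diagonal pair would force e = s, but s > 1. *)
move/eqP; rewrite -subr_eq0 -{2}[m]mul1r -mulrBl mulf_eq0 (negbTE m_neq0) orbF.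
rewrite subr_eq0 => /eqP es.
have {}es : e = s by rewrite -[s]mul1r -es; field.
by case: eP es => ->; lra.
Qed.

(** In the Gram representation by E_1, the vectors of [a] and [b] have equal norm and inner product
    minus its square, so they are opposite. *)
Lemma antipodal_entry a b c : v 1 a b = - m -> E_ 1 c a = - E_ 1 c b.
Proof.
move=> ab.
have EEab u w : \sum_d E_ 1 u d * E_ 1 w d = E_ 1 u w.
  have /matrixP/(_ u w) := EE (o 1) (o 1); rewrite mxE /= => <-.
  by apply: eq_bigr => d _; rewrite (symmx w d (trE _)).
have sum0 : \sum_d (E_ 1 a d + E_ 1 b d) ^+ 2 = 0.
  transitivity (E_ 1 a a + E_ 1 a b + (E_ 1 a b + E_ 1 b b)).
    rewrite -!EEab -!big_split; apply: eq_bigr => d _ /=; ring.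
  apply: (mulfI n_neq0); rewrite mulr0 !mulrDr !diagE ab; ring.
have /eqP : (E_ 1 a c + E_ 1 b c) ^+ 2 = 0.
  by apply: (psumr_eq0P _ sum0) => // d _; apply: sqr_ge0.
rewrite sqrf_eq0 addr_eq0 => /eqP.
by rewrite !(symmx c _ (trE _)).
Qed.

(** Equal signs at [c] rule out that [a] and [b] are antipodal. If they were far, their common
    neighbours [c] and [w] could not be collinear. *)
Lemma line_trans c a b w : S c a = 1 -> S c b = 1 -> S c w != 0 ->
    S a w != 0 -> S b w != 0 -> a = b \/ S a b != 0.
Proof.
move=> ca cb cw aw bw.
have ac : S a c != 0 by rewrite (symmx a c trmx_collinear_sign) ca oner_eq0.
have bc : S b c != 0 by rewrite (symmx b c trmx_collinear_sign) cb oner_eq0.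
have s1 := s_gt1; have x1 := x_gt1.
have E1pos d : S c d = 1 -> 0 < E_ 1 c d.
  case: (pairP c d) => [->|->|e _ -> _ _ _ -> _ ->|e _ ->]; try lra.
  by rewrite divr_gt0 //; nra.
case: (pairP a b) => [_ _ /antipodal_entry-/(_ c) E1ab | | e eP -> | e eP].
- have Ea := E1pos _ ca; have Eb := E1pos _ cb; exfalso; lra.
- by move=> _ _ ->; left.
- by move=> *; right; case: eP => ->; rewrite ?oppr_eq0 oner_eq0.
- move=> _ _ Fab BBab; case/eqP: cw.
  by apply: (collinear_clique (a := a) (b := b)) => //; rewrite Fab.
Qed.

Let sum_row (M : 'M[R]_n) a : \sum_u M a u = n%:R * (M *m E_ 0) a a.
Proof.
rewrite mxE mulr_sumr; apply: eq_bigr => u _.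
by rewrite mulrCA E0 mulr1.
Qed.

(** The row sums of [S] vanish while those of [B] are positive; without an entry 1, B + S would have
    a zero row. *)
Lemma exists_positive_collinear a : exists b, S a b = 1.
Proof.
have x1 := x_gt1.
have sumB : \sum_u B a u = 2 * x * (x + 1).
  rewrite sum_row /collinear !(mulmxDl, mulNmx) -!scalemxAl !EE /= !scaler0.
  by rewrite subr0 addr0 mxE mulrCA E0 mulr1.
have sumS : \sum_u S a u = 0.
  rewrite sum_row /collinear_sign -scalemxAl mulmxDl mulNmx !EE /=.
  by rewrite subr0 scaler0 mxE mulr0.
have [/existsP[b /eqP Sab] | /existsPn noS] := boolP [exists b, S a b == 1].
  by exists b.
have : \sum_u (B a u + S a u) = 0.
  apply: big1 => u _; rewrite collinear_sqr; have := noS u.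
  by case: (collinear_sign_val a u) => -> /eqP // _; ring.
by rewrite big_split sumB sumS /=; nra.
Qed.

Lemma no_pseudo_quadrangle (r : nat) : x = r%:R -> (r %% 4 = 3)%N -> False.
Proof.
move=> xr r3; pose c := Ordinal n_gt0.
have [y cy] := exists_positive_collinear c.
have Ssym := symmx _ _ trmx_collinear_sign.
(* This form is linear in [B] and [S], so sums over positive neighbours of [c] become entries of
   matrix products. *)
have indE u : ((S c u == 1)%:R : R) = (B c u + S c u) / 2.
  rewrite collinear_sqr; case: (collinear_sign_val c u) => ->.
  - by rewrite eq_sym oner_eq0 /=; field.
  - by rewrite eqxx /=; field.
  - by rewrite (_ : -1 == 1 :> R = false) /=; [field | apply/eqP; lra].
(* Restricting to sign 1 at [c] normalizes the signs; [L] is the clique through [y]. *)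
pose L u := (S c u == 1) && ((u == y) || (S y u != 0)).
have SB0 : S *m B = 0.
  rewrite -[S *m B]trmxK trmx_mul trmx_collinear trmx_collinear_sign.
  by rewrite mul_collinear_sign trmx0.
have sum_ind (M : 'M[R]_n) w : \sum_u M w u * (S c u == 1)%:R =
    ((M *m B) w c + (M *m S) w c) / 2.
  rewrite !mxE -big_split mulr_suml; apply: eq_bigr => u _ /=; rewrite indE.
  rewrite (symmx u c trmx_collinear) (symmx u c trmx_collinear_sign); ring.
have Lc w : L w -> S c w = 1 by case/andP => /eqP.
have one0 : (1 : R) != 0 by exact: oner_neq0.
have Lclosed w u : L w -> S c u = 1 -> S w u != 0 -> L u.
  move=> /andP[/eqP cw wy] cu wu; rewrite /L cu eqxx /=.
  case: eqP wy wu => [-> _ -> | _ /= yw wu]; first by rewrite orbT.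
  have := @line_trans c u y w cu cy; rewrite cw one0 Ssym wu yw.
  by case=> // [-> | ]; rewrite ?eqxx // Ssym => ->; rewrite orbT.
have Ladj w u : L w -> L u -> w = u \/ S w u != 0.
  move=> Lw Lu; have cw := Lc _ Lw; have cu := Lc _ Lu.
  case/andP: Lw => _ /orP[/eqP-> | yw]; case/andP: Lu => _ /orP[/eqP-> | yu].
  - by left.
  - by right.
  - by right; rewrite Ssym.
  - apply: (line_trans (c := c) (w := y)) => //.
    + by rewrite cy.
    + by rewrite Ssym.
    + by rewrite Ssym.
have LB w u : L w -> L u -> B w u = (u != w)%:R.
  move=> Lw Lu; rewrite collinear_sqr; case: (eqVneq u w) => [->|uw].
    by rewrite collinear_sign_diag expr0n.
  have [wu|] := Ladj _ _ Lw Lu; first by rewrite wu eqxx in uw.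
  by case: (collinear_sign_val w u) => ->; rewrite ?eqxx ?sqrrN ?expr1n.
have colc w : S c w = 1 -> (S *m S) w c = 0 /\ (B *m B) w c = 2 * (x - 1).
  rewrite -Ssym => wc; have wc0 : S w c != 0 by rewrite wc.
  have -> : (S *m S) w c = 2 * (x + 1) * F w c.
    by rewrite collinear_sign2 [LHS]mxE.
  case: (pairP w c) wc0 => [->|->|e _ _ _ -> -> _ _|e _ ->]; rewrite ?eqxx //.
  by rewrite mulr0.
(* By [Lclosed] the sum may run over all positive neighbours of [c]; then S B = 0 and S^2 vanishes
   at the collinear pair (w, c). *)
have rowL w : L w -> \sum_(u | L u) S w u = 0.
  move=> Lw; transitivity (\sum_u S w u * (S c u == 1)%:R).
    rewrite [RHS](bigID L) /= [X in _ + X]big1 ?addr0 => [|u nLu].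
      by apply: eq_bigr => u Lu; rewrite Lc // eqxx mulr1.
    case: eqP => [cu|_]; last by rewrite mulr0.
    case: (eqVneq (S w u) 0) => [->|wu]; first by rewrite mul0r.
    by rewrite (Lclosed w u) in nLu.
  rewrite sum_ind SB0 mxE; have [-> _] := colc w (Lc _ Lw).
  by rewrite addr0 mul0r.
(* Besides [y] there are (B^2)(y,c) / 2 = x - 1 members. *)
have cardL : \sum_(u | L u) 1 = x.
  transitivity (1 + \sum_u B y u * (S c u == 1)%:R).
    rewrite (bigD1 y) /=; last by rewrite /L cy !eqxx.
    congr (_ + _); rewrite big_mkcond /=; apply: eq_bigr => u _.
    rewrite /L collinear_sqr; case: (eqVneq u y) => [->|uy] /=.
      by rewrite collinear_sign_diag expr0n mul0r andbF.
    rewrite andbT; case: eqP => [cu|_] /=; last by rewrite mulr0.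
    by case: (collinear_sign_val y u) => ->;
      rewrite ?eqxx ?oppr_eq0 ?one0 ?sqrrN ?expr1n ?expr0n ?mulr1.
  rewrite sum_ind mul_collinear_sign [(0 : 'M_n) _ _]mxE.
  by have [_ ->] := colc y cy; field.
pose f w u := nat_of_bool [&& L w, L u & S w u == 1].
have f_even : ~~ odd (\sum_a \sum_b f a b).
  apply: sum_symmetric_even => [a b|a]; rewrite /f.
    by rewrite andbCA Ssym.
  by rewrite collinear_sign_diag eq_sym (negbTE one0) !andbF.
have sumf : (\sum_a \sum_b f a b)%:R = x * (x - 1) / 2 :> R.
  transitivity (\sum_(w | L w) \sum_(u | L u) (B w u + S w u) / 2).
    rewrite natr_sum [RHS]big_mkcond; apply: eq_bigr => w _ /=.
    rewrite natr_sum; case: ifP => Lw; last first.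
      by apply: big1 => u _; rewrite /f Lw.
    rewrite [RHS]big_mkcond; apply: eq_bigr => u _ /=; rewrite /f Lw /=.
    case: ifP => //= Lu; rewrite collinear_sqr.
    case: (collinear_sign_val w u) => ->.
    - by rewrite eq_sym (negbTE one0) /=; field.
    - by rewrite eqxx /=; field.
    - by rewrite (_ : -1 == 1 :> R = false) /=; [field | apply/eqP; lra].
  transitivity (\sum_(w | L w) (x - 1) / 2 * 1); last first.
    by rewrite -mulr_sumr cardL; ring.
  apply: eq_bigr => w Lw; rewrite -mulr_suml big_split /= rowL // addr0 mulr1.
  congr (_ / _); rewrite -cardL.
  rewrite [in RHS](bigD1 w) //= addrAC subrr add0r [LHS](bigD1 w) //=.
  rewrite LB // eqxx add0r; apply: eq_bigr => u /andP[Lu uw].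
  by rewrite LB // uw.
(* As the double sum is even, r (r - 1) would be divisible by 4, but it is 2 modulo 4. *)
have /eqP : (2 * \sum_a \sum_b f a b + r)%:R = (r * r)%:R :> R.
  by rewrite natrD !natrM sumf -xr; field.
rewrite eqr_nat => /eqP.
move: f_even; set K := (\sum_a _)%N => /even_halfK <-.
rewrite (divn_eq r 4) r3; nia.
Qed.

End PseudoQuadrangle.

(** * Idempotents and Krein parameters of a scheme *)

Lemma mem_span_image (K : fieldType) (V : vectType K) (I : finType)
    (F : I -> V) (u : V) :
    u \in <<[seq F i | i : I]>>%VS ->
  exists c : I -> K, u = \sum_i c i *: F i.
Proof.
rewrite span_def big_image /= => /memv_sumP[w wF ->].
have /fin_all_exists[c wE] i : exists c, w i = c *: F i.
  by have /vlineP := wF i isT.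
by exists c; apply: eq_bigr.
Qed.

Section OrthogonalIdempotents.

Variables (R : realType) (X : finType) (D : nat).
Variables (rel : 'I_D.+1 -> {set X * X}) (E : 'I_D.+1 -> 'M[R]_#|X|).
Hypothesis scheme : assoc_scheme R rel.
Hypothesis basisE : primitive_idempotent_basis rel E.

Local Notation A i := (adjmx R (rel i)).
Local Notation V := (bose_mesner R rel).

Lemma bose_mesnerP (M : 'M[R]_#|X|) :
  M \in V <-> exists c, M = \sum_i c i *: A i.
Proof.
split=> [/mem_span_image // | [c ->]].
apply: memv_suml => i _; apply/memvZ/memv_span/imageP; by exists i.
Qed.

Lemma bose_mesner_sym M : M \in V -> M^T = M.
Proof.
have [_ _ _ symA _] := scheme.
case/bose_mesnerP => c ->; rewrite linear_sum.
by apply: eq_bigr => i _ /=; rewrite linearZ /= symA.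
Qed.

Lemma bose_mesner_mul M N : M \in V -> N \in V -> M *m N \in V.
Proof.
have [_ _ _ _ [p Ap]] := scheme.
case/bose_mesnerP => c -> /bose_mesnerP[d ->].
rewrite mulmx_suml; apply: memv_suml => i _.
rewrite mulmx_sumr; apply: memv_suml => j _.
rewrite -scalemxAl -scalemxAr Ap; do 2!apply: memvZ.
by apply/bose_mesnerP; exists (fun k => (p i j k)%:R).
Qed.

(** The product lies in [V] again, hence is symmetric. *)
Lemma bose_mesnerC M N : M \in V -> N \in V -> M *m N = N *m M.
Proof.
move=> MV NV; rewrite -(bose_mesner_sym (bose_mesner_mul MV NV)) trmx_mul.
by rewrite !bose_mesner_sym.
Qed.

Lemma bose_mesner1 : 1%:M \in V.
Proof.
have [_ <- _ _ _] := scheme.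
by apply/memv_span/imageP; exists ord0.
Qed.

(** A_0 = I exhausts the diagonal of J, so every other A_i has zero diagonal. *)
Lemma bose_mesner_diag M : M \in V -> exists t, forall a, M a a = t.
Proof.
have [_ A0 sumA _ _] := scheme.
case/bose_mesnerP => c ->; exists (c ord0) => a.
have A00 : A ord0 a a = 1 by rewrite A0 mxE eqxx.
have Ai0 i : i != ord0 -> A i a a = 0.
  have /matrixP/(_ a a) := sumA; rewrite summxE mxE (bigD1 ord0) //= A00.
  move/eqP; rewrite -subr_eq0 addrAC subrr add0r => /eqP sum0 i0.
  by apply: (psumr_eq0P _ sum0) => // j _; rewrite mxE ler0n.
rewrite summxE (bigD1 ord0) //= mxE A00 mulr1 big1 ?addr0 // => i i0.
by rewrite mxE Ai0 // mulr0.
Qed.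

Let EV i : E i \in V.
Proof. by have [_ /(_ i)[[]]] := basisE. Qed.

Let Eid i : E i *m E i = E i.
Proof. by have [_ /(_ i)[[]]] := basisE. Qed.

Let E_neq0 i : E i != 0.
Proof. by have [_ /(_ i)[]] := basisE. Qed.

Lemma idempotent_sym i : (E i)^T = E i.
Proof. exact: bose_mesner_sym. Qed.

(* E_i = E_i E_j + E_i (1 - E_j) is a sum of orthogonal idempotents. *)
Lemma primitive_absorb i j : E i *m E j = 0 \/ E i *m E j = E i.
Proof.
have EC : E j *m E i = E i *m E j by exact: bose_mesnerC.
have [_ /(_ i)[_ _ prim] _] := basisE.
have EEij : E i *m E j *m (E i *m E j) = E i *m E j.
  by rewrite mulmxA -(mulmxA (E i)) EC mulmxA Eid -mulmxA Eid.
have EiEij : E i *m (E i *m E j) = E i *m E j by rewrite mulmxA Eid.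
have EijEi : E i *m E j *m E i = E i *m E j by rewrite -mulmxA EC.
have EVij := bose_mesner_mul (EV i) (EV j).
case: (prim (E i *m E j) (E i - E i *m E j)).
- by split.
- split; first by rewrite memvB.
  rewrite mulmxBl !mulmxBr Eid EiEij EijEi EEij subrr subr0 //.
- by rewrite mulmxBr EijEi EEij subrr.
- by rewrite mulmxBl EiEij EEij subrr.
- by rewrite addrC subrK.
- by left.
- by move/eqP; rewrite subr_eq0 => /eqP <-; right.
Qed.

(** If neither factor annihilates the other, each absorbs the other and both are equal, against
    freeness of the basis. *)
Lemma idempotent_mul i j : E i *m E j = if i == j then E i else 0.
Proof.
case: eqP => [->|ij]; first exact: Eid.
have [//|Eij] := primitive_absorb i j.
have [Eji|Eji] := primitive_absorb j i.
  by rewrite bose_mesnerC.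
case: ij; have [_ _ /basis_free/free_uniq/injectiveP injE] := basisE.
by apply: injE; rewrite -Eij -[RHS]Eji bose_mesnerC.
Qed.

Lemma idempotent_coef_inj (c d : 'I_D.+1 -> R) :
  \sum_k c k *: E k = \sum_k d k *: E k -> forall k, c k = d k.
Proof.
move=> cd k; move/(congr1 (mulmx^~ (E k))): cd.
have mulE (f : 'I_D.+1 -> R) : (\sum_i f i *: E i) *m E k = f k *: E k.
  rewrite mulmx_suml (bigD1 k) //= -scalemxAl idempotent_mul eqxx.
  rewrite big1 ?addr0 // => i /negbTE ik.
  by rewrite -scalemxAl idempotent_mul ik scaler0.
rewrite !mulE => /eqP; rewrite -subr_eq0 -scalerBl scaler_eq0.
by rewrite (negbTE (E_neq0 k)) orbF subr_eq0 => /eqP.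
Qed.

(** Multiplying the expansion of 1 by E_k shows that its coefficient at E_k is 1. *)
Lemma idempotent_sum : \sum_i E i = 1%:M.
Proof.
have [_ _ /span_basis spanE] := basisE.
have /mem_span_image[c one] : 1%:M \in <<[seq E i | i : 'I_D.+1]>>%VS.
  by rewrite spanE bose_mesner1.
have c1 k : c k = 1.
  apply/eqP; rewrite -subr_eq0 -[_ == 0]orbF -(negbTE (E_neq0 k)) -scaler_eq0.
  rewrite scalerBl scale1r subr_eq0 -[X in _ == X]mul1mx one mulmx_suml.
  rewrite (bigD1 k) //= -scalemxAl idempotent_mul eqxx big1 ?addr0 //.
  by move=> i /negbTE ik; rewrite -scalemxAl idempotent_mul ik scaler0.
by rewrite one; apply: eq_bigr => i _; rewrite c1 scale1r.
Qed.

Lemma card_scheme_gt0 : (0 < #|X|)%N.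
Proof.
have [/(_ ord0)/set0Pn[[a _] _] _ _ _ _] := scheme.
by apply/card_gt0P; exists a.
Qed.

Section KreinParameters.

Variable q : 'I_D.+1 -> 'I_D.+1 -> 'I_D.+1 -> R.
Hypothesis kreinE : krein_parameters E q.

Let X_neq0 : #|X|%:R != 0 :> R.
Proof. by rewrite pnatr_eq0 -lt0n card_scheme_gt0. Qed.

Lemma krein_parameter0 i k : q i ord0 k = (k == i)%:R.
Proof.
have [E0 _ _] := basisE.
apply: (@idempotent_coef_inj (q i ord0) (fun k => (k == i)%:R)).
apply: (scalerI (invr_neq0 X_neq0)); rewrite -kreinE.
rewrite [in RHS](bigD1 i) //= eqxx scale1r big1 => [|j /negbTE ->].
  by apply/matrixP => a b; rewrite addr0 E0 !mxE mulr1 mulrC.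
by rewrite scale0r.
Qed.

(** E_i o I is a multiple of I, as E_i has constant diagonal; expanding I as the sum of the E_j
    compares coefficients. This recovers the a*_k from the array. *)
Lemma krein_row_sum i :
  exists2 t, forall a, #|X|%:R * E i a a = t & forall k, \sum_j q i j k = t.
Proof.
have [t Et] := bose_mesner_diag (EV i).
exists (#|X|%:R * t) => [a|k]; first by rewrite Et.
apply: (@idempotent_coef_inj (fun k => \sum_j q i j k) (fun=> #|X|%:R * t)).
apply: (scalerI (invr_neq0 X_neq0)).
rewrite -[in RHS]scaler_sumr idempotent_sum scalerA mulKf //.
transitivity (\sum_j hadamard (E i) (E j)).
  under [RHS]eq_bigr => j _ do rewrite kreinE.
  rewrite -scaler_sumr exchange_big /=; congr (_ *: _).
  by apply: eq_bigr => l _; rewrite scaler_suml.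
apply/matrixP => a b; rewrite summxE.
under eq_bigr => j _ do rewrite mxE.
rewrite -mulr_sumr -summxE idempotent_sum !mxE.
by case: eqP => [->|_]; rewrite ?mulr0 // mulr1 Et mulr1.
Qed.

End KreinParameters.

End OrthogonalIdempotents.

(** * From the Krein array to the entrywise relations *)

Lemma inord6 (k : nat) (k_lt6 : (k < 6)%N) :
  inord k = @Ordinal 6 k k_lt6 :> 'I_6.
Proof. by apply: val_inj; rewrite /= inordK. Qed.

Local Notation o k := (@Ordinal 6 k isT).

Theorem theorem4p10 (R : realType) (r : nat) (r_gt0 : (0 < r)%N)
    (r_mod4 : (r = 3 %[mod 4])%N) :
  let x : R := r%:R in
  ~ exists (X : finType) (D : nat) (rel : 'I_D.+1 -> {set X * X}),
      Q_polynomial_scheme rel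
        [:: (x ^+ 2 + 1) / 2;
            (x ^+ 2 - 1) / 2;
            (x ^+ 2 + 1) ^+ 2 / (2 * x * (x + 1));
            (x - 1) * (x ^+ 2 + 1) / (4 * x);
            (x ^+ 2 + 1) / (2 * x)]
        [:: 1;
            (x - 1) * (x ^+ 2 + 1) / (2 * x * (x + 1));
            (x + 1) * (x ^+ 2 + 1) / (4 * x);
            (x - 1) * (x ^+ 2 + 1) / (2 * x);
            (x ^+ 2 + 1) / 2].
Proof.
move=> x [X [D [rel [scheme [E [q [basisE kreinE [_ Qpoly] [bD _ arr]]]]]]]].
(* The length of the array forces D = 5. *)
case: D bD => [|[|[|[|[|[|D]]]]]] // _
  in rel scheme E q basisE kreinE Qpoly arr *.
have r3 : (r %% 4 = 3)%N by rewrite r_mod4.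
have x1 : 1 < x.
  by rewrite ltr1n; case: r r3 {r_gt0 r_mod4 x Qpoly arr} => [|[|]].
pose s := Num.sqrt x.
have sx : s ^+ 2 = x by rewrite sqr_sqrtr // (le_trans ler01) // ltW.
have s1 : 1 < s by rewrite -[1]sqrtr1 ltr_sqrt // (lt_trans ltr01).
have X0 : #|X|%:R != 0 :> R by rewrite pnatr_eq0 -lt0n (card_scheme_gt0 scheme).
have io := (@inord6 0 isT, @inord6 1 isT, @inord6 2 isT, @inord6 3 isT,
            @inord6 4 isT, @inord6 5 isT).
have [b0 c1] := arr 0%N isT; have [b1 c2] := arr 1%N isT.
have [b2 c3] := arr 2%N isT; have [b3 c4] := arr 3%N isT.
have [b4 c5] := arr 4%N isT.
rewrite /= !io in b0 c1 b1 c2 b2 c3 b3 c4 b4 c5.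
have q0 (j k : 'I_6) : (j.+1 < k)%N || (k.+1 < j)%N -> q (o 1) j k = 0.
  by move=> /orP jk; have [+ _] := Qpoly j k; rewrite io; apply.
have z := (q0 (o 0) (o 2) isT, q0 (o 0) (o 3) isT, q0 (o 0) (o 4) isT,
            q0 (o 0) (o 5) isT, q0 (o 1) (o 3) isT, q0 (o 1) (o 4) isT,
            q0 (o 1) (o 5) isT, q0 (o 2) (o 0) isT, q0 (o 2) (o 4) isT,
            q0 (o 2) (o 5) isT, q0 (o 3) (o 0) isT, q0 (o 3) (o 1) isT,
            q0 (o 3) (o 5) isT, q0 (o 4) (o 0) isT, q0 (o 4) (o 1) isT,
            q0 (o 4) (o 2) isT, q0 (o 5) (o 0) isT, q0 (o 5) (o 1) isT,
            q0 (o 5) (o 2) isT, q0 (o 5) (o 3) isT).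
have q10 : q (o 1) (o 0) (o 0) = 0.
  rewrite (_ : o 0 = ord0); last exact: val_inj.
  by rewrite (krein_parameter0 scheme basisE kreinE).
have [t diagE row] := krein_row_sum scheme basisE kreinE (o 1).
have tE : t = (x ^+ 2 + 1) / 2.
  by rewrite -(row (o 0)) sum_ord6 q10 -b0 !z !addr0 add0r.
have x0 : x != 0 by rewrite gt_eqF // (lt_trans ltr01).
have xp1 : x + 1 != 0 by rewrite gt_eqF //; lra.
(* Row k reads c*_k + a*_k + b*_k = t, and the array already satisfies c*_k + b*_k = t. *)
have a_eq0 (c a b : R) : c + b = t -> c + a + b = t -> a = 0.
  by move=> cb cab; apply: (addrI c); apply: (addIr b); rewrite cab addr0 cb.
have a1 : q (o 1) (o 1) (o 1) = 0.
  have := row (o 1); rewrite sum_ord6 -c1 -b1 !z !addr0.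
  by apply: a_eq0; rewrite tE; field.
have a2 : q (o 1) (o 2) (o 2) = 0.
  have := row (o 2); rewrite sum_ord6 -c2 -b2 !z !addr0.
  by rewrite add0r; apply: a_eq0; rewrite tE; field; rewrite x0 xp1.
have a3 : q (o 1) (o 3) (o 3) = 0.
  have := row (o 3); rewrite sum_ord6 -c3 -b3 !z !addr0.
  by rewrite !add0r; apply: a_eq0; rewrite tE; field; rewrite x0.
have a4 : q (o 1) (o 4) (o 4) = 0.
  have := row (o 4); rewrite sum_ord6 -c4 -b4 !z.
  by rewrite !add0r; apply: a_eq0; rewrite tE; field; rewrite x0.
have a5 : q (o 1) (o 5) (o 5) = 0.
  have := row (o 5); rewrite sum_ord6 -c5 !z !add0r.
  (* The last row has no b*, so a zero takes its place. *)
  by rewrite -[X in X = _]addr0; apply: a_eq0; rewrite addr0 tE.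
have kreinv j a b : #|X|%:R * E (o 1) a b * (#|X|%:R * E j a b) =
    \sum_k q (o 1) j k * (#|X|%:R * E k a b).
  have /matrixP/(_ a b) := kreinE (o 1) j.
  rewrite !mxE summxE => /(congr1 ( *%R (#|X|%:R * #|X|%:R))).
  rewrite [RHS]mulrA mulfK // mulr_sumr => h.
  transitivity (#|X|%:R * #|X|%:R * (E (o 1) a b * E j a b)); first by ring.
  by rewrite h; apply: eq_bigr => k _; rewrite mxE; ring.
have [E0 _ _] := basisE.
apply: (no_pseudo_quadrangle (E := E) s1 (card_scheme_gt0 scheme)
          _ _ _ _ _ _ sx r3).
- exact: idempotent_sym scheme basisE.
- exact: idempotent_mul scheme basisE.
- exact: idempotent_sum scheme basisE.
- move=> a b; rewrite (_ : o 0 = ord0); last exact: val_inj.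
  by rewrite E0 !mxE mulr1 mulfV.
- by move=> a; rewrite sx diagE tE.
- move=> a b; rewrite sx !kreinv !sum_ord6.
  rewrite a1 a2 a3 a4 a5 -b0 -b1 -b2 -b3 -b4 -c2 -c3 -c4 -c5.
  by rewrite !z !mul0r !addr0 !add0r.
Qed.
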